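(* Let $\mathcal{D}\subset\mathbb{R}^d$ and let $n_x\in\mathbb{N}$, $n_x\geq 1$. For every $\mu\in\mathcal{D}$ let $M(\mu),D(\mu),K(\mu)\in\mathbb{R}^{n_x\times n_x}$ be symmetric and positive definite matrices (the mass, damping and stiffness matrices of a mechanical system). Let $\gamma:\mathcal{D}\to(0,\infty)$ be a function and define, for $\mu\in\mathcal{D}$, $$E(\mu):=\begin{bmatrix} K(\mu) & \gamma(\mu)M(\mu)\\ \gamma(\mu)M(\mu) & M(\mu)\end{bmatrix},\qquad A(\mu):=\begin{bmatrix} -\gamma(\mu)K(\mu) & K(\mu)-\gamma(\mu)D(\mu)\\ -K(\mu) & -D(\mu)+\gamma(\mu)M(\mu)\end{bmatrix}.$$ If for all $\mu\in\mathcal{D}$ it holds that $0<\gamma(\mu)<\gamma^*(\mu)$ with $$\gamma^*(\mu)=\frac{\lambda_{\min}(D(\mu))}{\lambda_{\max}(M(\mu))+\frac14\,\lambda_{\max}(D(\mu))^2\,\lambda_{\max}(K(\mu)^{-1})},$$ then the set of matrix pencils $\{sE(\mu)-A(\mu)\;|\;\mu\in\mathcal{D}\}$ is uniformly strictly dissipative.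
   Context: For a symmetric matrix $X$, $\lambda_{\min}(X)$ and $\lambda_{\max}(X)$ denote its smallest and largest eigenvalue; $X>0$ ($X<0$) means that $X$ is positive (negative) definite. Definition: a set $\{sE(\mu)-A(\mu)\in\mathbb{R}[s]^{n\times n}\;|\;\mu\in\mathcal{D}\}$ of matrix pencils is called uniformly strictly dissipative if for all $\mu\in\mathcal{D}$ $$E(\mu)=E(\mu)^{\mathrm T}>0\quad\text{and}\quad A^S(\mu):=\tfrac12\big(A(\mu)+A(\mu)^{\mathrm T}\big)<0.$$ *)

(* Defs.v *)
From HB Require Import structures.
From mathcomp Require Import all_boot all_order all_algebra.
From mathcomp Require Import boolp classical_sets reals.

Set Implicit Arguments.
Unset Strict Implicit.
Unset Printing Implicit Defensive.

Import Order.TTheory GRing.Theory Num.Theory.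
Local Open Scope classical_set_scope.
Local Open Scope ring_scope.

Section Defs.
Variable R : realType.

(* For a symmetric real matrix of positive size the set of eigenvalues is
   finite and nonempty, so the default value 0 of xget is not used. *)
Definition lambda_min (n : nat) (X : 'M[R]_n) : R :=
  xget 0 [set a | eigenvalue X a /\ forall b, eigenvalue X b -> a <= b].

Definition lambda_max (n : nat) (X : 'M[R]_n) : R :=
  xget 0 [set a | eigenvalue X a /\ forall b, eigenvalue X b -> b <= a].

(* Symmetry is not part of these two predicates; it is stated separately. *)
Definition posdef (n : nat) (X : 'M[R]_n) : Prop :=
  forall v : 'cV[R]_n, v != 0 -> 0 < (v^T *m X *m v) 0 0.

Definition negdef (n : nat) (X : 'M[R]_n) : Prop :=
  forall v : 'cV[R]_n, v != 0 -> (v^T *m X *m v) 0 0 < 0.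

Definition sym_part (n : nat) (A : 'M[R]_n) : 'M[R]_n := 2^-1 *: (A + A^T).

Definition pencil (n : nat) (E A : 'M[R]_n) : 'M[{poly R}]_n :=
  'X *: map_mx polyC E - map_mx polyC A.

(* E and A are determined by the pencil 'X E - A (pencil_inj), so the
   existential is harmless; see uniformly_strictly_dissipativeP. *)
Definition uniformly_strictly_dissipative (n : nat)
    (S : set 'M[{poly R}]_n) : Prop :=
  forall P, S P -> exists E A : 'M[R]_n,
    [/\ P = pencil E A, E = E^T, posdef E & negdef (sym_part A)].

Lemma pencil_inj (n : nat) (E A E' A' : 'M[R]_n) :
  pencil E A = pencil E' A' -> E = E' /\ A = A'.
Proof.
move=> /matrixP eqP.
have coef i j k : ('X * (E i j)%:P - (A i j)%:P)`_k
                = ('X * (E' i j)%:P - (A' i j)%:P)`_k.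
  by have := eqP i j; rewrite !mxE => ->.
split; apply/matrixP => i j.
- by have := coef i j 1%N; rewrite !coefB !coefXM !coefC /= !subr0.
- by have := coef i j 0%N; rewrite !coefB !coefXM !coefC /= !sub0r => /oppr_inj.
Qed.

Lemma uniformly_strictly_dissipativeP (T : Type) (n : nat) (Dom : set T)
    (E A : T -> 'M[R]_n) :
  uniformly_strictly_dissipative [set pencil (E mu) (A mu) | mu in Dom] <->
  (forall mu, Dom mu ->
     [/\ E mu = (E mu)^T, posdef (E mu) & negdef (sym_part (A mu))]).
Proof.
split=> [H mu Dmu | H P [mu Dmu <-]].
  have [|E' [A' [/pencil_inj [<- <-] sE pE nA]]] := H (pencil (E mu) (A mu)).
    by exists mu.
  by split.
by have [sE pE nA] := H _ Dmu; exists (E mu), (A mu).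
Qed.

(* M, D, K are the mass, damping and stiffness matrices, g is gamma. *)
Definition mech_E (n : nat) (M K : 'M[R]_n) (g : R) : 'M[R]_(n + n) :=
  block_mx K (g *: M) (g *: M) M.

Definition mech_A (n : nat) (M D K : 'M[R]_n) (g : R) : 'M[R]_(n + n) :=
  block_mx (- (g *: K)) (K - g *: D) (- K) (- D + g *: M).

Definition gamma_star (n : nat) (M D K : 'M[R]_n) : R :=
  lambda_min D /
  (lambda_max M + 4^-1 * lambda_max D ^+ 2 * lambda_max (invmx K)).

End Defs.

(* Main.v *)
Require Import Defs.
From HB Require Import structures.
From mathcomp Require Import all_boot all_order all_algebra.
From mathcomp Require Import boolp classical_sets reals.
From mathcomp Require Import ring lra.

Import Order.TTheory GRing.Theory Num.Theory.
Local Open Scope classical_set_scope.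
Local Open Scope ring_scope.

(* Completing squares in v = (x, y) gives
     v^T E v   = (y + g x)^T M (y + g x) + x^T (K - g^2 M) x,
     v^T A^S v = - g (x^T K x + x^T D y) - y^T D y + g y^T M y.
   With k := lambda_max (K^-1) one has k K >= I, hence
     x^T K x + x^T D y >= - k/4 |D y|^2 >= - k/4 lambda_max(D)^2 |y|^2,
   so g < gamma_star makes A^S negative definite.  By AM-GM the denominator of
   gamma_star is at least lambda_max(D) sqrt(k lambda_max(M)), hence
   g^2 k lambda_max(M) < 1, which makes K - g^2 M positive definite.

   The Rayleigh bounds for symmetric X are obtained without compactness: if t
   is the supremum of the s with X - s I >= 0, then X - t I is positive
   semidefinite; were it invertible, it would be bounded below by a positive
   multiple of I, contradicting the choice of t. *)

Section Rayleigh.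
Set Implicit Arguments.
Unset Strict Implicit.
Variables (R : realType) (n : nat).
Implicit Types (X Y : 'M[R]_n) (u v : 'cV[R]_n) (a c s : R).

(** * Quadratic forms and the squared Euclidean norm *)

Definition bform X u v : R := (u^T *m X *m v) 0 0.
Definition sqnorm v : R := bform 1%:M v v.

Lemma bformC X u v : X^T = X -> bform X u v = bform X v u.
Proof.
move=> sX; rewrite /bform -[in LHS](trmxK (u^T *m X *m v)) mxE.
by rewrite !trmx_mul trmxK sX mulmxA.
Qed.

Lemma bformDm X Y u v : bform (X + Y) u v = bform X u v + bform Y u v.
Proof. by rewrite /bform mulmxDr mulmxDl mxE. Qed.

Lemma bformNm X u v : bform (- X) u v = - bform X u v.
Proof. by rewrite /bform mulmxN mulNmx mxE. Qed.

Lemma bformZm a X u v : bform (a *: X) u v = a * bform X u v.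
Proof. by rewrite /bform -scalemxAr -scalemxAl mxE. Qed.

Lemma bform_scalar a u v : bform a%:M u v = a * bform 1%:M u v.
Proof. by rewrite -(scalemx1 n a) bformZm. Qed.

Lemma bform_lincomb X u v s : X^T = X ->
  bform X (u + s *: v) (u + s *: v)
  = bform X u u + 2 * s * bform X u v + s ^+ 2 * bform X v v.
Proof.
move=> sX; have vu := bformC v u sX; move: vu.
have -> : bform X (u + s *: v) = fun w => ((u^T + s *: v^T) *m X *m w) 0 0.
  by rewrite /bform linearD linearZ.
rewrite /bform !(mulmxDl, mulmxDr) -!scalemxAr -!scalemxAl.
by rewrite !mxE => ->; ring.
Qed.

Lemma bform0r X u : bform X u 0 = 0.
Proof. by rewrite /bform mulmx0 mxE. Qed.

Lemma bform_mulmx X u v : bform X u v = bform 1%:M u (X *m v).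
Proof. by rewrite /bform mulmx1 mulmxA. Qed.

Lemma sqnormE v : sqnorm v = \sum_i v i 0 ^+ 2.
Proof.
by rewrite /sqnorm /bform mulmx1 mxE; apply: eq_bigr => i _; rewrite mxE expr2.
Qed.

Lemma sqnorm_ge0 v : 0 <= sqnorm v.
Proof. by rewrite sqnormE; apply: sumr_ge0 => i _; rewrite sqr_ge0. Qed.

Lemma sqnorm_gt0 v : v != 0 -> 0 < sqnorm v.
Proof.
move=> v0; rewrite lt0r sqnorm_ge0 andbT; apply: contra v0.
rewrite sqnormE psumr_eq0 => [/allP h|i _]; last exact: sqr_ge0.
apply/eqP/matrixP => i j; rewrite ord1 mxE.
by have := h i (mem_index_enum _); rewrite sqrf_eq0 => /eqP.
Qed.

Lemma bform_bounded X :
  exists2 c, 0 < c & forall v, `|bform X v v| <= c * sqnorm v.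
Proof.
(* The entrywise sum already bounds the form; the summand 1 makes the constant positive even for
   [X = 0]. *)
exists (1 + \sum_j \sum_i `|X i j|).
  by rewrite ltr_pwDl ?ltr01 ?sumr_ge0// => j _; rewrite sumr_ge0.
move=> v; rewrite mulrDl mul1r; apply: ler_wpDl; first exact: sqnorm_ge0.
rewrite /bform mxE mulr_suml; apply: le_trans (ler_norm_sum _ _ _) _.
apply: ler_sum => j _; rewrite mxE !mulr_suml.
apply: le_trans (ler_norm_sum _ _ _) _; apply: ler_sum => i _.
have coord k : v k 0 ^+ 2 <= sqnorm v.
  rewrite sqnormE (bigD1 k)//= lerDl sumr_ge0// => l _; exact: sqr_ge0.
have cross : `|v i 0 * v j 0| <= sqnorm v.
  have := coord i; have := coord j; rewrite ler_norml; move: (sqnorm v) => N.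
  by move=> hj hi; apply/andP; split; nra.
have -> : v^T 0 i * X i j * v j 0 = X i j * (v i 0 * v j 0) by rewrite mxE; ring.
by rewrite normrM ler_wpM2l.
Qed.

(** * Bounds for positive semidefinite forms *)

(* Cauchy-Schwarz for the semidefinite form Y: expand 0 <= (u - s v)^T Y (u - s v)
   and take s = c^-1. *)
Lemma psd_cauchy_bound Y u v c : Y^T = Y -> (forall w, 0 <= bform Y w w) ->
  0 < c -> bform Y v v <= c * bform Y u v -> bform Y u v <= c * bform Y u u.
Proof.
move=> sY pY c0; have := pY (u + (- c^-1) *: v); rewrite bform_lincomb//.
move: (bform Y u u) (bform Y u v) (bform Y v v) => p q r h hr.
have cc : c * c^-1 = 1 by rewrite divff ?gt_eqF.
have c'0 : 0 < c^-1 by rewrite invr_gt0.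
have : c^-1 ^+ 2 * r <= c^-1 ^+ 2 * (c * q) by rewrite ler_wpM2l ?sqr_ge0.
have -> : c^-1 ^+ 2 * (c * q) = c^-1 * q by rewrite expr2 -mulrA mulKf ?gt_eqF.
move=> h2; have h3 : c^-1 * q <= p by move: h; rewrite sqrrN; lra.
by move: h3; rewrite ler_pdivrMl.
Qed.

(** Apply [psd_cauchy_bound] to [v] and [w = Y^-1 v]: then [v^T Y w = |v|^2] and
    [w^T Y w = v^T Y^-1 v]. *)
Lemma psd_inv_lower Y c : Y^T = Y -> (forall w, 0 <= bform Y w w) ->
  Y \in unitmx -> 0 < c ->
  (forall v, bform (invmx Y) v v <= c * sqnorm v) ->
  forall v, sqnorm v <= c * bform Y v v.
Proof.
move=> sY pY uY c0 bY v.
have E1 : bform Y v (invmx Y *m v) = sqnorm v.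
  by rewrite bform_mulmx mulKVmx.
have E2 : bform Y (invmx Y *m v) (invmx Y *m v) = bform (invmx Y) v v.
  by rewrite bform_mulmx mulKVmx// bformC ?trmx1// -bform_mulmx.
by rewrite -E1; apply: psd_cauchy_bound; rewrite ?E1 ?E2.
Qed.

(** Apply [psd_cauchy_bound] to [v] and [Y v], where [v^T Y (Y v) = |Y v|^2]; this gives one factor
    [c], and the bound on [Y] gives the other. *)
Lemma psd_sqr_upper Y c : Y^T = Y -> (forall w, 0 <= bform Y w w) -> 0 < c ->
  (forall v, bform Y v v <= c * sqnorm v) ->
  forall v, sqnorm (Y *m v) <= c ^+ 2 * sqnorm v.
Proof.
move=> sY pY c0 bY v.
have E1 : bform Y v (Y *m v) = sqnorm (Y *m v).
  by rewrite bformC// bform_mulmx.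
rewrite -E1; apply: le_trans (_ : c * bform Y v v <= _).
  by apply: psd_cauchy_bound; rewrite ?E1.
by rewrite expr2 -mulrA ler_pM2l.
Qed.

(** * Extreme eigenvalues and Rayleigh bounds *)

Lemma eigenvalue_bform X a : X^T = X -> eigenvalue X a ->
  exists2 v, v != 0 & bform X v v = a * sqnorm v.
Proof.
move=> sX /eigenvalueP[v vX v0]; exists v^T; first by rewrite trmx_eq0.
by rewrite /sqnorm /bform trmxK vX mulmx1 -scalemxAl mxE.
Qed.

Lemma rayleigh_min X : (0 < n)%N -> X^T = X ->
  exists2 a, eigenvalue X a & forall v, a * sqnorm v <= bform X v v.
Proof.
move=> n0 sX; pose S : set R := [set t | forall v, t * sqnorm v <= bform X v v].
have [c c0 bX] := bform_bounded X.
have S0 : S !=set0.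
  by exists (- c) => v; have := bX v; rewrite ler_norml mulNr => /andP[].
have [w w0] : exists w : 'cV[R]_n, w != 0.
  exists (const_mx 1); apply/eqP => /matrixP/(_ (Ordinal n0) 0).
  by rewrite !mxE => /eqP; rewrite oner_eq0.
have ubS v : v != 0 -> ubound S (bform X v v / sqnorm v).
  by move=> v0 t /(_ v); rewrite ler_pdivlMr ?sqnorm_gt0.
have supS v : sup S * sqnorm v <= bform X v v.
  have [->|v0] := eqVneq v 0.
    by rewrite /sqnorm !bform0r mulr0.
  by rewrite -ler_pdivlMr ?sqnorm_gt0//; apply: ge_sup => //; apply: ubS.
exists (sup S) => //; pose Y := X - (sup S)%:M.
have YE v : bform Y v v = bform X v v - sup S * sqnorm v.
  by rewrite bformDm bformNm bform_scalar.
have sY : Y^T = Y by rewrite linearB /= tr_scalar_mx sX.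
have pY v : 0 <= bform Y v v by rewrite YE subr_ge0.
have [uY|nuY] := boolP (Y \in unitmx); last first.
  (* If [Y] is singular, a nonzero row vector in its kernel is an eigenvector of [X] for [sup S]. *)
  move: nuY; rewrite -row_free_unit -kermx_eq0 => /rowV0Pn[v /sub_kermxP vY v0].
  apply/eigenvalueP; exists v => //.
  by apply/eqP; rewrite -subr_eq0 -mul_mx_scalar -mulmxBr vY.
(* If [Y] is invertible, a bound [e] on its inverse gives [Y >= e^-1 I], so [sup S + e^-1] would lie
   in [S]. *)
have [e e0 bI] := bform_bounded (invmx Y).
have lowY := psd_inv_lower sY pY uY e0 (fun v => le_trans (ler_norm _) (bI v)).
have : S (sup S + e^-1).
  move=> v; rewrite mulrDl addrC -lerBrDr -YE ler_pdivrMl//; exact: lowY.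
have hS : has_ubound S by exists (bform X w w / sqnorm w); apply: ubS.
by move/(ub_le_sup hS); rewrite gerDl leNgt invr_gt0 e0.
Qed.

Lemma rayleigh_max X : (0 < n)%N -> X^T = X ->
  exists2 a, eigenvalue X a & forall v, bform X v v <= a * sqnorm v.
Proof.
move=> n0 sX; have sNX : (- X)^T = - X by rewrite linearN /= sX.
have [a /eigenvalueP[v vX v0] ha] := rayleigh_min n0 sNX.
exists (- a); last by move=> w; have := ha w; rewrite bformNm mulNr; lra.
by apply/eigenvalueP; exists v; rewrite // scaleNr -vX mulmxN opprK.
Qed.

(** The value from [rayleigh_min] is a least eigenvalue, so [xget] finds a witness and its default 0
    is not taken. *)
Lemma lambda_minP X : (0 < n)%N -> X^T = X ->
  eigenvalue X (lambda_min X) /\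
  forall v, lambda_min X * sqnorm v <= bform X v v.
Proof.
move=> n0 sX; have [a ea ha] := rayleigh_min n0 sX.
have [|el hl] := @xgetPex _ 0
    [set a | eigenvalue X a /\ forall b, eigenvalue X b -> a <= b].
  exists a; split=> // b /(eigenvalue_bform sX)[v v0 bv].
  by have := ha v; rewrite bv ler_pM2r ?sqnorm_gt0.
split=> // v; apply: le_trans (ha v); apply: ler_wpM2r; first exact: sqnorm_ge0.
exact: hl.
Qed.

Lemma lambda_maxP X : (0 < n)%N -> X^T = X ->
  eigenvalue X (lambda_max X) /\
  forall v, bform X v v <= lambda_max X * sqnorm v.
Proof.
move=> n0 sX; have [a ea ha] := rayleigh_max n0 sX.
have [|el hl] := @xgetPex _ 0
    [set a | eigenvalue X a /\ forall b, eigenvalue X b -> b <= a].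
  exists a; split=> // b /(eigenvalue_bform sX)[v v0 bv].
  by have := ha v; rewrite bv ler_pM2r ?sqnorm_gt0.
split=> // v; apply: le_trans (ha v) _; apply: ler_wpM2r; first exact: sqnorm_ge0.
exact: hl.
Qed.

(** * Positive definite matrices and their inverses *)

Lemma posdef_bform_ge0 X : posdef X -> forall v, 0 <= bform X v v.
Proof.
move=> pX v; have [->|/pX/ltW//] := eqVneq v 0.
by rewrite bform0r.
Qed.

Lemma posdef_eigenvalue_gt0 X a : X^T = X -> posdef X -> eigenvalue X a -> 0 < a.
Proof.
move=> sX pX /(eigenvalue_bform sX)[v v0 bv].
by have := pX v v0; rewrite -/(bform X v v) bv pmulr_lgt0 ?sqnorm_gt0.
Qed.

Lemma posdef_unitmx X : posdef X -> X \in unitmx.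
Proof.
move=> pX; rewrite -row_free_unit -kermx_eq0; apply/negPn/negP.
move=> /rowV0Pn[v /sub_kermxP vX v0].
have := pX v^T; rewrite trmx_eq0 trmxK vX mul0mx mxE ltxx => /(_ v0).
by [].
Qed.

(** With [w = X^-1 v], the form of [X^-1] at [v] is the form of [X] at [w]. *)
Lemma posdef_invmx X : X^T = X -> posdef X -> posdef (invmx X).
Proof.
move=> sX pX v v0; have uX := posdef_unitmx pX.
have w0 : invmx X *m v != 0.
  by apply: contra v0 => /eqP h; rewrite -(mulKVmx uX v) h mulmx0.
by have := pX _ w0; rewrite trmx_mul trmx_inv sX mulmxKV // mulmxA.
Qed.

Lemma posdef_inv_lower X : (0 < n)%N -> X^T = X -> posdef X ->
  0 < lambda_max (invmx X) /\
  forall v, sqnorm v <= lambda_max (invmx X) * bform X v v.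
Proof.
move=> n0 sX pX; have sI : (invmx X)^T = invmx X by rewrite trmx_inv sX.
have [eI bI] := lambda_maxP n0 sI.
have k0 := posdef_eigenvalue_gt0 sI (posdef_invmx sX pX) eI.
split=> //; apply: psd_inv_lower => //; first exact: posdef_bform_ge0.
exact: posdef_unitmx.
Qed.

End Rayleigh.

(** * The quadratic forms of the mechanical pencil *)

Section Mechanical.
Set Implicit Arguments.
Unset Strict Implicit.
Variables (R : realType) (n : nat).
Implicit Types (M D K X : 'M[R]_n) (x y : 'cV[R]_n) (g : R).

(** The skew part of [X] contributes nothing to the quadratic form. *)
Lemma sym_part_bform m (X : 'M[R]_m) v : bform (sym_part X) v v = bform X v v.
Proof.
rewrite bformZm bformDm (_ : bform X^T v v = bform X v v); first by field.
by rewrite /bform -[in LHS](trmxK (v^T *m _ *m v)) mxE !trmx_mul !trmxK mulmxA.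
Qed.

Lemma bform_block (X Y Z W : 'M[R]_n) x y :
  bform (block_mx X Y Z W) (col_mx x y) (col_mx x y)
  = bform X x x + bform Y x y + bform Z y x + bform W y y.
Proof.
rewrite /bform tr_col_mx mul_row_block mul_row_col !mulmxDl !mxE; ring.
Qed.

Lemma mech_E_bform M K g x y : M^T = M ->
  bform (mech_E M K g) (col_mx x y) (col_mx x y)
  = bform M (y + g *: x) (y + g *: x) + (bform K x x - g ^+ 2 * bform M x x).
Proof.
move=> sM; rewrite bform_block bform_lincomb// !bformZm (bformC x y sM); ring.
Qed.

(** The off-diagonal contributions [x^T K y] and [- y^T K x] cancel by symmetry of [K]. *)
Lemma mech_A_bform M D K g x y : K^T = K ->
  bform (mech_A M D K g) (col_mx x y) (col_mx x y)
  = - g * (bform K x x + bform D x y) - bform D y y + g * bform M y y.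
Proof.
move=> sK; rewrite bform_block !(bformDm, bformNm, bformZm) (bformC y x sK); ring.
Qed.

Lemma mech_E_sym M K g : M^T = M -> K^T = K -> mech_E M K g = (mech_E M K g)^T.
Proof. by move=> sM sK; rewrite tr_block_mx !linearZ /= sM sK. Qed.

Variables (M D K : 'M[R]_n) (g : R).
Hypotheses (n0 : (0 < n)%N) (sM : M^T = M) (sD : D^T = D) (sK : K^T = K).
Hypotheses (pM : posdef M) (pD : posdef D) (pK : posdef K).
Hypotheses (g0 : 0 < g) (ggs : g < gamma_star M D K).

(** * Consequences of the bound on gamma *)

Lemma lambda_maxM_gt0 : 0 < lambda_max M.
Proof. exact: posdef_eigenvalue_gt0 sM pM (lambda_maxP n0 sM).1. Qed.

Lemma lambda_maxD_gt0 : 0 < lambda_max D.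
Proof. exact: posdef_eigenvalue_gt0 sD pD (lambda_maxP n0 sD).1. Qed.

Lemma gamma_bound :
  g * (lambda_max M + 4^-1 * lambda_max D ^+ 2 * lambda_max (invmx K))
  < lambda_min D.
Proof.
rewrite -ltr_pdivlMr//; apply: ltr_pwDl; first exact: lambda_maxM_gt0.
have [/ltW k0 _] := posdef_inv_lower n0 sK pK.
by rewrite mulr_ge0// mulr_ge0 ?sqr_ge0// invr_ge0 ler0n.
Qed.

Lemma lambda_min_le_max : lambda_min D <= lambda_max D.
Proof.
have [ed _] := lambda_minP n0 sD; have [_ hD] := lambda_maxP n0 sD.
have [v v0 bv] := eigenvalue_bform sD ed.
by have := hD v; rewrite bv ler_pM2r ?sqnorm_gt0.
Qed.

Lemma gamma_sqr_bound : g ^+ 2 * lambda_max (invmx K) * lambda_max M < 1.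
Proof.
have := lt_le_trans gamma_bound lambda_min_le_max.
have L0 := lambda_maxD_gt0; have m0 := lambda_maxM_gt0.
have [k0 _] := posdef_inv_lower n0 sK pK; move: L0 m0 k0.
move: (lambda_max D) (lambda_max M) (lambda_max (invmx K)) => L m k L0 m0 k0 h.
have p0 : 0 < g * (m + 4^-1 * L ^+ 2 * k).
  by rewrite mulr_gt0// addr_gt0// mulr_gt0// mulr_gt0 ?exprn_gt0// invr_gt0.
have h2 : (g * (m + 4^-1 * L ^+ 2 * k)) ^+ 2 < L ^+ 2.
  by rewrite ltr_pXn2r ?nnegrE ?ltW.
have amgm : 0 <= (g * (m - 4^-1 * L ^+ 2 * k)) ^+ 2 by exact: sqr_ge0.
(* This is [(m + b)^2 = (m - b)^2 + 4 m b] with [b = L^2 k / 4], scaled by [g^2]. *)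
have E : (g * (m + 4^-1 * L ^+ 2 * k)) ^+ 2
   = (g * (m - 4^-1 * L ^+ 2 * k)) ^+ 2 + L ^+ 2 * (g ^+ 2 * k * m) by field.
have : L ^+ 2 * (g ^+ 2 * k * m) < L ^+ 2 * 1 by rewrite mulr1; lra.
by rewrite ltr_pM2l ?exprn_gt0.
Qed.

Lemma mech_E_posdef : posdef (mech_E M K g).
Proof.
move=> v; rewrite -[v]vsubmxK; move: (usubmx v) (dsubmx v) => x y v0.
rewrite -/(bform _ _ _) mech_E_bform//.
have [x0|x0] := eqVneq x 0.
  have y0 : y != 0 by apply: contra v0 => /eqP ->; rewrite x0 col_mx0.
  rewrite x0 scaler0 addr0 !bform0r mulr0 subr0 addr0; exact: pM.
apply: ltr_wpDl; first exact: posdef_bform_ge0.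
have [k0 hK] := posdef_inv_lower n0 sK pK.
have [_ hM] := lambda_maxP n0 sM.
have N0 := sqnorm_gt0 x0.
(* After multiplication by [k = lambda_max (invmx K)] the chain is [k g^2 x^T M x <= k g^2
   lambda_max(M) |x|^2 < |x|^2 <= k x^T K x]. *)
rewrite subr_gt0 -(ltr_pM2l k0); apply: lt_le_trans (hK x).
have gk : 0 <= lambda_max (invmx K) * g ^+ 2 by rewrite mulr_ge0 ?sqr_ge0 ?ltW.
rewrite mulrA; apply: le_lt_trans (ler_wpM2l gk (hM x)) _.
by rewrite mulrA -[ltRHS]mul1r ltr_pM2r// [_ * g ^+ 2]mulrC gamma_sqr_bound.
Qed.

Lemma mech_A_negdef : negdef (sym_part (mech_A M D K g)).
Proof.
move=> v; rewrite -/(bform _ v v) sym_part_bform -[v]vsubmxK.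
move: (usubmx v) (dsubmx v) => x y v0; rewrite mech_A_bform//.
have [y0|y0] := eqVneq y 0.
  have x0 : x != 0 by apply: contra v0 => /eqP ->; rewrite y0 col_mx0.
  rewrite y0 !bform0r mulr0 !addr0 subr0 mulNr oppr_lt0 mulr_gt0//.
  exact: pK.
have [k0 hK] := posdef_inv_lower n0 sK pK.
have [_ hM] := lambda_maxP n0 sM.
have [_ hd] := lambda_minP n0 sD.
have hD : sqnorm (D *m y) <= lambda_max D ^+ 2 * sqnorm y.
  apply: psd_sqr_upper => //; first exact: posdef_bform_ge0.
  - exact: lambda_maxD_gt0.
  - exact: (lambda_maxP n0 sD).2.
(* The factor [k / 2] completes the square: [0 <= |x|^2 + k x^T D y + (k^2 / 4) |D y|^2]. Since
   [|x|^2 <= k x^T K x], division by [k] yields [h1]. *)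
have sq := sqnorm_ge0 (x + (lambda_max (invmx K) / 2) *: (D *m y)).
rewrite /sqnorm bform_lincomb ?trmx1// -bform_mulmx in sq.
have := hK x; have := hM y; have := hd y; have N0 := sqnorm_gt0 y0.
have gb := gamma_bound; move: hD sq k0 gb N0; rewrite -/(sqnorm x) -/(sqnorm (D *m y)).
move: (bform K x x) (bform D x y) (bform D y y) (bform M y y) => p q r s.
move: (sqnorm (D *m y)) (sqnorm y) (sqnorm x) => w Ny Nx.
move: (lambda_max (invmx K)) (lambda_max D) (lambda_max M) (lambda_min D) => k L m l.
move=> hD sq k0 gb N0 hr hs hNx.
have h1 : 0 <= p + q + 4^-1 * k * w.
  by rewrite -(pmulr_rge0 _ k0); move: sq hNx; lra.
(* Together: [- g (p + q) + g s <= g (k L^2 / 4 + m) Ny < l Ny <= r]. *)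
have h2 : 0 <= g * (p + q + 4^-1 * k * w) by rewrite mulr_ge0// ltW.
have h3 : g * s <= g * (m * Ny) by rewrite ler_pM2l.
have h4 : g * k * w <= g * k * (L ^+ 2 * Ny) by rewrite ler_pM2l// mulr_gt0.
have h5 : g * (m + 4^-1 * L ^+ 2 * k) * Ny < l * Ny by rewrite ltr_pM2r.
lra.
Qed.

End Mechanical.

Theorem theorem4p5 (R : realType) (d nx : nat) (hnx : (1 <= nx)%N)
    (Dom : set 'rV[R]_d) (M D K : 'rV[R]_d -> 'M[R]_nx)
    (hM : forall mu, Dom mu -> M mu \is symmetricmx /\ posdef (M mu))
    (hD : forall mu, Dom mu -> D mu \is symmetricmx /\ posdef (D mu))
    (hK : forall mu, Dom mu -> K mu \is symmetricmx /\ posdef (K mu))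
    (gamma : 'rV[R]_d -> R)
    (hgamma : forall mu, Dom mu ->
       0 < gamma mu < gamma_star (M mu) (D mu) (K mu)) :
  uniformly_strictly_dissipative
    [set pencil (mech_E (M mu) (K mu) (gamma mu))
                (mech_A (M mu) (D mu) (K mu) (gamma mu)) | mu in Dom].
Proof.
have symE (X : 'M[R]_nx) : X \is symmetricmx -> X^T = X.
  (* [symmetricmx] is the Hermitian predicate with sign exponent 0 and the identity as
     conjugation. *)
  by move=> /is_hermitianmxP eX; rewrite {2}eX expr0 scale1r map_mx_id.
apply/uniformly_strictly_dissipativeP => mu Dmu.
have [/symE sM pM] := hM mu Dmu; have [/symE sD pD] := hD mu Dmu.
have [/symE sK pK] := hK mu Dmu; have /andP[g0 ggs] := hgamma mu Dmu.
split; first exact: mech_E_sym.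
- exact: mech_E_posdef ggs.
- exact: mech_A_negdef.
Qed.
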